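(* Let $H:\mathbb{R}^n\rightrightarrows\mathbb{R}^n$ be a closed convex process and let $\mathcal{K}\subseteq\mathbb{R}^n$ be a weakly $H$ invariant closed convex cone such that - $H(0)\cap\mathcal{K}$ is a subspace, - $\operatorname{lin}(\mathcal{K})$ is weakly $L_-(H)$ invariant, and - $\operatorname{lin}(\mathcal{K})\subseteq (L_-(H)-\lambda I)\operatorname{lin}(\mathcal{K})$ for all real $\lambda\geq 0$. Then $\mathcal{K}=\operatorname{lin}(\mathcal{K})$ if and only if every eigenvector of $H$ in $\mathcal{K}$ corresponding to an eigenvalue $\lambda\geq 0$ belongs to $\operatorname{lin}(\mathcal{K})$.
   Context: A nonempty set $\mathcal{C}\subseteq\mathbb{R}^n$ is a cone if $\rho x\in\mathcal{C}$ for all $x\in\mathcal{C}$ and $\rho\geq 0$ (so $0\in\mathcal{C}$). For a convex cone $\mathcal{C}$, $\operatorname{lin}(\mathcal{C}):=\mathcal{C}\cap(-\mathcal{C})$, the largest subspace contained in $\mathcal{C}$. A set-valued map $H:\mathbb{R}^n\rightrightarrows\mathbb{R}^n$ is identified with its graph $\operatorname{gr}(H):=\{(x,y)\in\mathbb{R}^n\times\mathbb{R}^n\mid y\in H(x)\}$. $H$ is a convex process if $\operatorname{gr}(H)$ is a convex cone, a closed convex process if moreover $\operatorname{gr}(H)$ is closed, and a linear process if $\operatorname{gr}(H)$ is a subspace. The minimal linear process $L_-(H)$ of a convex process $H$ is defined by $\operatorname{gr}(L_-(H)):=\operatorname{lin}(\operatorname{gr}(H))$. For $\lambda\in\mathbb{R}$,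 $(H-\lambda I)(x):=\{y-\lambda x\mid y\in H(x)\}$. For a set $\mathcal{S}\subseteq\mathbb{R}^n$, the image of $\mathcal{S}$ under $H$ is $H(\mathcal{S}):=\{y\in\mathbb{R}^n\mid \exists x\in\mathcal{S}\text{ with }y\in H(x)\}$; thus $(L-\lambda I)\mathcal{S}$ denotes the image of $\mathcal{S}$ under $L-\lambda I$. A convex cone $\mathcal{C}$ is weakly $H$ invariant if $H(x)\cap\mathcal{C}\neq\varnothing$ for all $x\in\mathcal{C}$. A real number $\lambda$ is an eigenvalue of $H$ with corresponding eigenvector $\xi\in\mathbb{R}^n\setminus\{0\}$ if $\lambda\xi\in H(\xi)$. *)

(* Defs.v *)
From mathcomp Require Import all_boot all_order all_algebra.
From mathcomp Require Import all_classical all_reals all_analysis.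
Import Order.TTheory GRing.Theory Num.Theory.
Import numFieldNormedType.Exports.

Set Implicit Arguments.
Unset Strict Implicit.
Unset Printing Implicit Defensive.

Local Open Scope classical_set_scope.
Local Open Scope ring_scope.

Section Cones.
Variables (R : realType) (V : lmodType R).
Implicit Type C : set V.

Definition cone C : Prop :=
  C !=set0 /\ forall (x : V) (rho : R), C x -> 0 <= rho -> C (rho *: x).

(* [convex_set] is stated on convex spaces; [convex_lmodType V] is [V] itself
   equipped with the usual convex combinations. *)
Definition convex_cone C : Prop :=
  cone C /\ convex_set (C : set (convex_lmodType V)).

Definition lin C : set V := C `&` [set - x | x in C].

Definition linear_subspace C : Prop := submod_closed (mem C).

End Cones.

Section Processes.
Variables (R : realType) (n : nat).
Local Notation Rn := 'rV[R]_n.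
Implicit Types (H : Rn -> set Rn) (S : set Rn).

Definition gr H : set (Rn * Rn) := [set xy | H xy.1 xy.2].

(* The matrix topology on [Rn] is the product topology on the coordinates,
   that is, the usual topology of the Euclidean space. *)
Definition closed_convex_process H : Prop :=
  convex_cone (gr H) /\ closed (gr H).

Definition min_linear_process H : Rn -> set Rn :=
  fun x => [set y | lin (gr H) (x, y)].

Lemma gr_min_linear_process H : gr (min_linear_process H) = lin (gr H).
Proof. by apply/seteqP; split=> -[x y]. Qed.

Definition shift_process H (lambda : R) : Rn -> set Rn :=
  fun x => [set y - lambda *: x | y in H x].

Definition process_image H S : set Rn := [set y | exists2 x, S x & H x y].

Definition weakly_invariant H S : Prop :=
  forall x, S x -> (H x `&` S) !=set0.

Definition eigenpair H (lambda : R) (xi : Rn) : Prop :=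
  xi != 0 /\ H xi (lambda *: xi).

End Processes.

(* Main.v *)
Require Import Defs.
From mathcomp Require Import all_boot all_order all_algebra.
From mathcomp Require Import all_classical all_reals all_analysis.
From mathcomp Require Import ring lra.
Import Order.TTheory GRing.Theory Num.Theory.
Import numFieldNormedType.Exports.
Set Implicit Arguments.
Unset Strict Implicit.

Local Open Scope classical_set_scope.
Local Open Scope ring_scope.

(** If [K] is a subspace it equals [lin K] and nothing is left to prove about
    eigenvectors.  For the converse, put [W := lin K] and [V := H 0 `&` K], two
    subspaces, and choose projections [p] and [q] with kernels [W] and [V].
    The reduced graph is the closed convex cone [G] of all [(x, y)] in [gr H]
    with [x] and [y] in [K], [x *m p = x] and [y *m q = y].  Consider on [G] the
    linear maps

      T t (x, y) := x *m p - t *: ((x + y) *m p)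
                  = ((1 - t) *: x - t *: y) *m p,     0 <= t <= 1,

    which join [x *m p] (at [t = 0]) to [- y *m p] (at [t = 1]).

    The kernel of [T t] meets [G] only in [0] ([reduced_gr_kernel]).  Indeed if
    [T t (x, y) = 0] with [t > 0], then [y - l *: x] lies in [W] for
    [l := (1 - t) / t >= 0]; solving the corresponding equation inside [W]
    corrects [(x, y)] to [(x - a, y - b)] with [y - b = l *: (x - a)], so
    [x - a] is zero or an eigenvector of [H] in [K].  By hypothesis it is in
    [W], hence so is [x], and reducedness gives [x = 0] and then [y = 0].

    Therefore the property that [T t] maps [G] onto a set containing the
    projected cone [K *m p] propagates from [t = 0], where it is weak
    invariance ([reduced_gr_onto]), to [t = 1]
    ([surjective_continuation]): injectivity on [G] and compactness give a
    lower bound on [`|T t g|], and this bound allows one to move [t] by a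
    Neumann type iteration inside the cone ([surjective_perturbation]).

    At [t = 1] each [z] in [K] satisfies [z *m p = - y *m p] for some [y] in
    [K].  Then [z + y] is in [W], so [- z = - (z + y) + y] is in [K], that is,
    [z] is in [lin K]. *)

(** * Convex cones and their lineality spaces *)

Lemma convex_cone0 (R : realType) (V : lmodType R) (C : set V) :
  convex_cone C -> C 0.
Proof. by move=> [[[x Cx] CZ] _]; rewrite -(scale0r x); exact: CZ. Qed.

Lemma convex_coneZ (R : realType) (V : lmodType R) (C : set V) (a : R) (x : V) :
  convex_cone C -> 0 <= a -> C x -> C (a *: x).
Proof. by move=> [[_ CZ] _] a0 Cx; exact: CZ. Qed.

Lemma convex_coneD (R : realType) (V : lmodType R) (C : set V) (x y : V) :
  convex_cone C -> C x -> C y -> C (x + y).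
Proof.
move=> [[_ CZ] Cconv] Cx Cy.
have half0 : (0 : R) <= 2^-1 by rewrite invr_ge0 ler0n.
have half1 : (2^-1 : R) <= 1 by rewrite invf_le1 ?ler1n ?ltr0n.
have : C (2^-1 *: x + (1 - 2^-1) *: y).
  have := Cconv x y (Itv01 half0 half1) (mem_set Cx) (mem_set Cy).
  by rewrite inE.
move=> /CZ /(_ (ler0n _ 2)).
rewrite scalerDr !scalerA mulrBr mulr1 mulfV ?pnatr_eq0//.
by rewrite (_ : 2 - 1 = 1 :> R) ?scale1r//; ring.
Qed.

Lemma convex_coneP (R : realType) (V : lmodType R) (C : set V) :
  C 0 -> (forall x y, C x -> C y -> C (x + y)) ->
  (forall (a : R) x, 0 <= a -> C x -> C (a *: x)) -> convex_cone C.
Proof.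
move=> C0 CD CZ; split; first by split=> [|x a Cx a0]; [exists 0|exact: CZ].
move=> x y l; rewrite !inE => Cx Cy.
by apply: CD; apply: CZ; rewrite // ?subr_ge0.
Qed.

Lemma linP (R : realType) (V : lmodType R) (C : set V) (x : V) :
  lin C x <-> C x /\ C (- x).
Proof.
split=> [[Cx [y Cy yx]]|[Cx CNx]]; first by rewrite -yx opprK yx.
by split=> //; exists (- x); rewrite ?opprK.
Qed.

Lemma lin_subspace (R : realType) (V : lmodType R) (C : set V) :
  convex_cone C -> linear_subspace (lin C).
Proof.
move=> Ccc; split; rewrite ?inE.
  by apply/linP; rewrite oppr0; split; exact: convex_cone0.
move=> a u v; rewrite !inE => /linP[Cu CNu] /linP[Cv CNv]; apply/linP.
have [a0|/ltW a0] := leP 0 a.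
  split; first by apply: convex_coneD => //; exact: convex_coneZ.
  by rewrite opprD -scalerN; apply: convex_coneD => //; exact: convex_coneZ.
rewrite opprD -scaleNr -[a *: u]opprK -scaleNr -scalerN.
by split; apply: convex_coneD => //; apply: convex_coneZ; rewrite ?oppr_ge0.
Qed.

(** * Linear maps on a cone with compact bounded part *)

(** By homogeneity the constant is the minimum of [f] over the unit sphere of
    the cone, which is positive because it is attained. *)
Lemma cone_coercive (R : realType) (E : normedModType R) (G : set E)
    (f : E -> R) :
  convex_cone G ->
  compact (G `&` [set g | `|g| <= 1]) ->
  continuous f ->
  (forall (a : R) g, 0 <= a -> G g -> f (a *: g) = a * f g) ->
  (forall g, G g -> g != 0 -> 0 < f g) ->
  exists2 d, 0 < d & forall g, G g -> d * `|g| <= f g.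
Proof.
move=> Gcc Gcpt fC fZ fpos.
pose S := (G `&` [set g | `|g| <= 1]) `&` [set g | `|g| = 1].
have Scpt : compact S.
  apply: compact_closedI => //.
  have /continuous_closedP nC := @norm_continuous R E.
  by have := nC _ (@closed_eq R 1).
have GS g : G g -> g != 0 -> S (`|g|^-1 *: g).
  move=> Gg g0; have ng : `| `|g|^-1 *: g| = 1.
    by rewrite normrZ normfV normr_id mulVf// normr_eq0.
  by split=> //=; split; [exact: convex_coneZ|rewrite /= ng].
have f0 g : G g -> g = 0 -> f g = 0.
  by move=> Gg g0; rewrite -[RHS](mul0r (f g)) -fZ// scale0r -g0.
have [S0|/set0P S0] := eqVneq S set0.
  (* With an empty unit sphere the cone is reduced to [0]. *)
  exists 1 => // g Gg; rewrite mul1r.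
  have [g0|g0] := eqVneq g 0; first by rewrite (f0 g)// g0 normr0.
  by have := GS g Gg g0; rewrite S0.
have [c cS cmin] := compact_EVT_min S0 Scpt (continuous_subspaceT fC).
move: (cS); rewrite inE => -[[Gc _] /= nc].
exists (f c).
  by apply: fpos => //; rewrite -normr_eq0 nc oner_eq0.
move=> g Gg; have [g0|g0] := eqVneq g 0.
  by rewrite (f0 g)// g0 normr0 mulr0.
have := cmin _ (mem_set (GS g Gg g0)); rewrite fZ// ler_pdivlMl ?normr_gt0//.
by rewrite mulrC.
Qed.

(** A Neumann iteration that stays in the cone.  If [u] and [v] in [G] satisfy
    [A u - t *: B u + (t - s) *: B v = z], choose [h] in [G] with
    [A h - s *: B h = (t - s) *: B v]; then the pair [(u + h, h)] satisfies the
    same equation, and the lower bound [d] makes [`|h|] at most half of [`|v|].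
    So [z] is approximated arbitrarily well by values at points of [G] that
    remain in a fixed ball, and compactness turns this into an exact solution.
    The series of corrections itself is never summed, which dispenses with
    completeness of [E]. *)
Lemma surjective_perturbation (R : realType) (E F : normedModType R)
    (A B : {linear E -> F}) (G : set E) (P : set F) (s t b d : R) :
  continuous A -> continuous B ->
  convex_cone G ->
  (forall C, compact (G `&` [set g | `|g| <= C])) ->
  (forall g, G g -> P (B g)) ->
  (forall g, `|B g| <= b * `|g|) ->
  0 < d -> (forall g, G g -> d * `|g| <= `|A g - s *: B g|) ->
  s <= t -> 2 * ((t - s) * b) <= d ->
  P `<=` [set A g - s *: B g | g in G] ->
  P `<=` [set A g - t *: B g | g in G].
Proof.
move=> cA cB Gcc Gcpt BP Bb d0 Tcoer st std PT z Pz.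
have [g0 Gg0 Tg0] := PT z Pz.
have approx (N : nat) : exists u v, [/\ G u, G v,
    A u - t *: B u + (t - s) *: B v = z, `|u| + `|v| <= 2 * `|g0| &
    `|v| <= `|g0| / 2 ^+ N].
  elim: N => [|N [u [v [Gu Gv uvz uv vN]]]].
    exists g0, g0; split=> //.
    - by rewrite -Tg0 scalerBl addrA subrK.
    - by rewrite mulr_natl mulr2n.
    - by rewrite expr0 divr1.
  have [h0 Gh0 Th0] := PT _ (BP _ Gv).
  have ts0 : 0 <= t - s by rewrite subr_ge0.
  pose h := (t - s) *: h0.
  have Gh : G h by exact: convex_coneZ.
  have Th : A h - s *: B h = (t - s) *: B v.
    by rewrite -Th0 scalerBr scalerA mulrC -scalerA /h !linearZ /=.
  move: h Gh Th => h Gh Th.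
  have hv : `|h| <= `|v| / 2.
    have := Tcoer h Gh; rewrite Th normrZ ger0_norm// => dh.
    have : (t - s) * `|B v| <= (t - s) * (b * `|v|) by rewrite ler_wpM2l.
    have : 2 * ((t - s) * b) * `|v| <= d * `|v| by rewrite ler_wpM2r.
    have -> : 2 * ((t - s) * b) * `|v| = 2 * ((t - s) * (b * `|v|)) by ring.
    move=> h1 h2.
    rewrite -(ler_pM2l d0); lra.
  exists (u + h), h; split=> //; first exact: convex_coneD.
  - rewrite -uvz -Th [A _]linearD [B _]linearD scalerDr scalerBl opprD.
    rewrite [X in X + _ = _]addrACA -[LHS]addrA; congr (_ + _);
    by rewrite addrA subrK.
  - by have := ler_normD u h; lra.
  - rewrite exprSr invfM mulrA; lra.
have [u0 [v0 [Gu0 _ _ uv0 _]]] := approx 0%N.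
(* The residual is minimized over the ball that contains all approximants. *)
pose f g := `|A g - t *: B g - z|.
have cf : continuous f.
  move=> x; apply: cvg_norm; apply: cvgB; last exact: cvg_cst.
  by apply: cvgB; [exact: cA|apply: cvgZl_tmp; exact: cB].
have D0 : (G `&` [set g | `|g| <= 2 * `|g0|]) !=set0.
  by exists u0; split=> //=; have := normr_ge0 v0; lra.
have [m mD mmin] := compact_EVT_min D0 (Gcpt _) (continuous_subspaceT cf).
move: mD; rewrite inE => -[Gm _].
exists m => //; apply/eqP; rewrite -subr_eq0 -normr_eq0 -/(f m).
rewrite eq_le normr_ge0 andbT leNgt; apply/negP => fm.
have [N hN] : exists N : nat, d * `|g0| / f m < 2 ^+ N.
  exists (Num.bound (d * `|g0| / f m)).
  apply: (lt_trans (archi_boundP _)).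
    by rewrite divr_ge0 ?mulr_ge0// ltW.
  by rewrite -natrX ltr_nat ltn_expl.
have [u [v [Gu _ uvz uv vN]]] := approx N.
have uD : u \in G `&` [set g | `|g| <= 2 * `|g0|].
  by rewrite inE; split=> //=; have := normr_ge0 v; lra.
have := mmin u uD; rewrite {2}/f -uvz opprD addNKr normrN normrZ.
rewrite ger0_norm ?subr_ge0// => fmv.
have : (t - s) * `|B v| <= (t - s) * (b * `|v|).
  by rewrite ler_wpM2l ?subr_ge0.
have : 2 * ((t - s) * b) * `|v| <= d * `|v| by rewrite ler_wpM2r.
have -> : 2 * ((t - s) * b) * `|v| = 2 * ((t - s) * (b * `|v|)) by ring.
have : d * `|v| <= d * (`|g0| / 2 ^+ N) by rewrite ler_wpM2l// ltW.
have : d * `|g0| / 2 ^+ N < f m.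
  by move: hN; rewrite !ltr_pdivrMr ?exprn_gt0// [2 ^+ N * _]mulrC.
rewrite -!mulrA; lra.
Qed.

(** The parameters [t] at which [A - t B] covers [P] fill up [[0, 1]].  At the
    supremum [s] of these parameters the map still has a lower bound [d] on [G],
    by injectivity; the bound persists, up to a factor, at nearby parameters, so
    a good parameter slightly below [s] can be pushed a definite step past
    [s], unless [1] is reached first. *)
Lemma surjective_continuation (R : realType) (E F : normedModType R)
    (A B : {linear E -> F}) (G : set E) (P : set F) :
  continuous A -> continuous B ->
  convex_cone G ->
  (forall C, compact (G `&` [set g | `|g| <= C])) ->
  (forall g, G g -> P (B g)) ->
  (forall (t : R) g, 0 <= t <= 1 -> G g -> A g - t *: B g = 0 -> g = 0) ->
  P `<=` A @` G ->
  P `<=` [set A g - B g | g in G].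
Proof.
move=> cA cB Gcc Gcpt BP inj PA.
have coercive t : 0 <= t <= 1 -> exists2 d, 0 < d &
    forall g, G g -> d * `|g| <= `|A g - t *: B g|.
  move=> t01; apply: cone_coercive => //.
  - move=> x; apply: cvg_norm.
    by apply: cvgB; [exact: cA|apply: cvgZl_tmp; exact: cB].
  - move=> a g a0 _; rewrite [A _]linearZ [B _]linearZ/= scalerA [t * a]mulrC.
    rewrite -scalerA -scalerBr.
    by rewrite normrZ ger0_norm.
  - by move=> g Gg; rewrite normr_gt0; apply: contraNN => /eqP /inj ->.
have [b b0 Bb] : exists2 b, 0 < b & forall g, `|B g| <= b * `|g|.
  have /linear_boundedP/pinfty_ex_gt0[b b0 bB] :=
    (linear_bounded_continuous B).2 cB.
  by exists b.
pose onto t := P `<=` [set A g - t *: B g | g in G].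
pose S := [set t : R | 0 <= t <= 1 /\ onto t].
have S0 : S 0.
  split; first by rewrite lexx ler01.
  by move=> z /PA[g Gg <-]; exists g; rewrite ?scale0r ?subr0.
have Sub : ubound S 1 by move=> t [/andP[]].
have Ssup : has_sup S by split; [exists 0|exists 1].
have s0 : 0 <= sup S by exact: sup_upper_bound.
have s1 : sup S <= 1 by apply: sup_le_ub => //; exists 0.
have [d d0 dco] := coercive (sup S) (introT andP (conj s0 s1)).
(* Moving the parameter by [e] moves the lower bound by at most [d / 8], which
   leaves [d / 2] after one such move and room for a step of length [2 * e]. *)
pose e := d / (8 * b).
have e0 : 0 < e by rewrite divr_gt0// mulr_gt0.
have eb : e * b = d / 8 by rewrite /e; field; rewrite gt_eqF.
have [s [/andP[s00 s11] onto_s] ss] := sup_adherent e0 Ssup.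
have sle : s <= sup S by apply: sup_upper_bound => //; split=> //; apply/andP.
pose t := Num.min 1 (s + 2 * e).
have st : s <= t by rewrite le_min s11/= lerDl mulr_ge0// ltW.
have tse : t - s <= 2 * e by rewrite lerBlDl ge_min lexx orbT.
have onto_t : onto t.
  apply: (@surjective_perturbation _ _ _ A B G P s t b (d / 2)) => //.
  - by rewrite divr_gt0.
  - move=> g Gg.
    have := dco g Gg.
    have -> : A g - sup S *: B g = A g - s *: B g - (sup S - s) *: B g.
      by rewrite scalerBl opprB addrA subrK.
    have := ler_normB (A g - s *: B g) ((sup S - s) *: B g).
    rewrite normrZ ger0_norm ?subr_ge0//.
    have : (sup S - s) * `|B g| <= e * (b * `|g|).
      by apply: ler_pM; rewrite ?subr_ge0//; lra.
    rewrite mulrA eb; have := mulr_ge0 (ltW d0) (normr_ge0 g); lra.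
  - have : (t - s) * b <= 2 * e * b by rewrite ler_wpM2r// ltW.
    rewrite -mulrA eb; lra.
have t1 : t <= 1 by rewrite ge_min lexx.
have : t <= sup S.
  apply: sup_upper_bound => //; split=> //.
  by rewrite t1 (le_trans _ st).
move: onto_t; rewrite /t.
case: (leP 1 (s + 2 * e)) => [_ onto1 _|_ _]; last by lra.
by move=> z /onto1[g Gg <-]; exists g; rewrite ?scale1r.
Qed.

(** * Finite-dimensional preliminaries *)

Lemma rV_linear_continuous (R : realType) (n : nat) (F : normedModType R)
    (f : {linear 'rV[R]_n -> F}) : continuous f.
Proof.
have -> : (f : 'rV[R]_n -> F) = \sum_i (fun x => x 0 i *: f (delta_mx 0 i)).
  apply/funext => x; rewrite fct_sumE {1}(row_sum_delta x) linear_sum/=.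
  by apply: eq_bigr => i _; rewrite linearZ.
elim/big_ind : _ => [|g h cg ch|i _] x.
- exact: (@cst_continuous _ _ (0 : F)).
- exact: (continuousD (cg x) (ch x)).
- exact: cvgZr_tmp (@coord_continuous R 1 n 0 i x).
Qed.

(** A subspace given as a set of row vectors is the row space of a matrix [A]
    of maximal rank among those whose row space it contains; then
    [pinvmx A *m A] is a projection onto it and its complement [p] a projection
    along it. *)
Lemma subspace_projection (R : realType) (n : nat) (S : set 'rV[R]_n) :
  linear_subspace S ->
  exists2 p : 'M[R]_n, p *m p = p & forall x, S x <-> x *m p = 0.
Proof.
move=> [S0 Slin].
have SD a u v : S u -> S v -> S (a *: u + v).
  by move=> Su Sv; apply/set_mem/Slin; rewrite inE.
pose inS (A : 'M[R]_n) := forall v : 'rV_n, (v <= A)%MS -> S v.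
pose rk r := `[< exists2 A, inS A & \rank A = r >].
have rk0 : exists r, rk r.
  exists 0%N; apply/asboolP; exists 0; last exact: mxrank0.
  by move=> v; rewrite submx0 => /eqP ->; exact: set_mem.
have rk_le r : rk r -> (r <= n)%N.
  by move=> /asboolP[A _ <-]; exact: rank_leq_row.
case: (ex_maxnP rk0 rk_le) => r /asboolP[A AS rA] rmax.
have SA v : S v -> (v <= A)%MS.
  move=> Sv; have AvS : inS (A + v)%MS.
    move=> w /sub_addsmxP[[u1 u2] /= ->].
    have /sub_rVP[a ->] := submxMl u2 v.
    by rewrite addrC; apply: SD => //; apply: AS; exact: submxMl.
  have /rmax : rk (\rank (A + v)%MS) by apply/asboolP; exists (A + v)%MS.
  rewrite -rA => rAv.
  have AAv : (A == A + v)%MS.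
    by rewrite -mxrank_leqif_eq ?addsmxSl// eqn_leq rAv mxrankS ?addsmxSl.
  by rewrite (eqmxP AAv) addsmxSr.
pose p := 1%:M - pinvmx A *m A.
have AKp m (v : 'M[R]_(m, n)) : (v <= A)%MS -> v *m p = 0.
  by move=> vA; rewrite mulmxBr mulmx1 mulmxA mulmxKpV// subrr.
exists p; first by rewrite {1}/p mulmxBl mul1mx AKp ?submxMl// subr0.
move=> x; split=> [/SA/AKp//|].
rewrite mulmxBr mulmx1 mulmxA => /subr0_eq ->.
by apply: AS; exact: submxMl.
Qed.

(** * The reduced graph *)

(** The part of the graph of [H] inside [K], normalized modulo the subspaces
    killed by the projections [p] and [q]: fixing representatives this way
    replaces a passage to quotient spaces, and is what makes the maps of the
    continuation injective. *)
Definition reduced_gr (R : realType) (n : nat) (H : 'rV[R]_n -> set 'rV[R]_n)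
    (K : set 'rV[R]_n) (p q : 'M[R]_n) : set ('rV[R]_n * 'rV[R]_n) :=
  [set g | [/\ gr H g, K g.1, K g.2, g.1 *m p = g.1 & g.2 *m q = g.2]].

Lemma reduced_gr_convex_cone (R : realType) (n : nat)
    (H : 'rV[R]_n -> set 'rV[R]_n) (K : set 'rV[R]_n) (p q : 'M[R]_n) :
  convex_cone (gr H) -> convex_cone K -> convex_cone (reduced_gr H K p q).
Proof.
move=> Hcc Kcc; apply: convex_coneP.
- by split; rewrite ?mul0mx//; exact: convex_cone0.
- move=> g h [Hg Kg1 Kg2 pg qg] [Hh Kh1 Kh2 ph qh].
  by split; rewrite ?mulmxDl ?pg ?qg ?ph ?qh//; exact: convex_coneD.
- move=> a g a0 [Hg Kg1 Kg2 pg qg].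
  by split; rewrite -?scalemxAl ?pg ?qg//; exact: convex_coneZ.
Qed.

Lemma reduced_gr_compact (R : realType) (n : nat)
    (H : 'rV[R]_n -> set 'rV[R]_n) (K : set 'rV[R]_n) (p q : 'M[R]_n) (C : R) :
  closed (gr H) -> closed K ->
  compact (reduced_gr H K p q `&` [set g | `|g| <= C]).
Proof.
move=> Hcl Kcl.
have norm_closed (f : 'rV[R]_n -> 'rV[R]_n) (D : set R) : continuous f ->
    closed D -> closed [set x | D `|f x|].
  move=> cf; have /continuous_closedP : continuous (fun x => `|f x|).
    by move=> x; apply: (continuous_comp (cf x)); exact: norm_continuous.
  by apply.
have ball_compact : compact [set x : 'rV[R]_n | `|x| <= C].
  apply: bounded_closed_compact.
    exists C; split; first exact: num_real.
    by move=> M CM x /le_trans; apply; exact: ltW.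
  apply: (norm_closed id [set r | r <= C]); last exact: (@closed_le R C).
  by move=> x.
have fixed_closed (m : 'M[R]_n) : closed [set x : 'rV[R]_n | x *m m = x].
  have -> : [set x : 'rV[R]_n | x *m m = x] = [set x | `|mulmxr m x - x| = 0].
    apply/seteqP; split=> x /= => [->|/normr0_eq0/subr0_eq//].
    by rewrite subrr normr0.
  apply: (norm_closed _ [set r | r = 0]); last exact: (@closed_eq R 0).
  move=> x; apply: (continuousB (f := mulmxr m)); last exact: cvg_id.
  exact: rV_linear_continuous.
have fst_cont : continuous (fst : 'rV[R]_n * 'rV[R]_n -> 'rV[R]_n).
  by move=> g; exact: cvg_fst.
have snd_cont : continuous (snd : 'rV[R]_n * 'rV[R]_n -> 'rV[R]_n).
  by move=> g; exact: cvg_snd.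
have fst_closed (D : set 'rV[R]_n) : closed D ->
    closed [set g : 'rV[R]_n * 'rV[R]_n | D g.1].
  by have /continuous_closedP := fst_cont; apply.
have snd_closed (D : set 'rV[R]_n) : closed D ->
    closed [set g : 'rV[R]_n * 'rV[R]_n | D g.2].
  by have /continuous_closedP := snd_cont; apply.
have -> : reduced_gr H K p q `&` [set g | `|g| <= C] =
    [set x | `|x| <= C] `*` [set y | `|y| <= C] `&`
    (gr H `&` ([set g | K g.1] `&` ([set g | K g.2] `&`
      ([set g | g.1 *m p = g.1] `&` [set g | g.2 *m q = g.2])))).
  apply/seteqP; split.
    move=> [x y] [[? ? ? ? ?] /=].
    by rewrite prod_normE ge_max => /andP[].
  move=> [x y] [[/= xC yC] [? [? [? []]]]].
  by split=> //=; rewrite prod_normE ge_max xC.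
apply: compact_closedI; first exact: (compact_setX ball_compact ball_compact).
apply: closedI => //; apply: closedI; first exact: (fst_closed _ Kcl).
apply: closedI; first exact: (snd_closed _ Kcl).
apply: closedI; first exact: (fst_closed _ (fixed_closed p)).
exact: (snd_closed _ (fixed_closed q)).
Qed.

(** The only lemma where eigenvectors enter: a zero of the map at parameter [t]
    is, modulo [lin K], an eigenvector for [(1 - t) / t]. *)
Lemma reduced_gr_kernel (R : realType) (n : nat)
    (H : 'rV[R]_n -> set 'rV[R]_n) (K : set 'rV[R]_n) (p q : 'M[R]_n)
    (t : R) (x y : 'rV[R]_n) :
  convex_cone (gr H) -> convex_cone K ->
  (forall lambda : R, 0 <= lambda ->
     lin K `<=`
     process_image (shift_process (min_linear_process H) lambda) (lin K)) ->
  (forall (lambda : R) (xi : 'rV[R]_n),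
     0 <= lambda -> eigenpair H lambda xi -> K xi -> lin K xi) ->
  (forall x, lin K x <-> x *m p = 0) ->
  (forall y, (H 0 `&` K) y <-> y *m q = 0) ->
  0 <= t <= 1 -> reduced_gr H K p q (x, y) ->
  x *m p - t *: ((x + y) *m p) = 0 -> (x, y) = 0.
Proof.
move=> Hcc Kcc img eig pK qK /andP[t0 t1] [/= Hxy Kx Ky px qy] Txy.
have [lin0 linD] := lin_subspace Kcc.
have linK a u v : lin K u -> lin K v -> lin K (a *: u + v).
  by move=> Ku Kv; apply/set_mem/linD; rewrite inE.
suff Wx : lin K x.
  have x0 : x = 0 by rewrite -px; exact/pK.
  by rewrite x0 in Hxy *; congr (_, _); rewrite -qy; apply/qK; split.
have Ww : lin K ((1 - t) *: x - t *: y).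
  apply/pK; rewrite -Txy mulmxBl -!scalemxAl mulmxDl scalerBl scale1r scalerDr.
  by rewrite opprD addrA.
(* At [t = 0], an infinite eigenvalue, [x] itself is in [lin K]. *)
have [t00|tn0] := eqVneq t 0.
  by move: Ww; rewrite t00 subr0 scale1r scale0r subr0.
pose l := (1 - t) / t.
have l0 : 0 <= l by rewrite divr_ge0// subr_ge0.
have Wu : lin K (y - l *: x).
  have -> : y - l *: x = - t^-1 *: ((1 - t) *: x - t *: y) + 0.
    rewrite addr0 scalerBr !scalerA !mulNr mulVf// scaleN1r opprK addrC scaleNr.
    by rewrite [t^-1 * _]mulrC.
  by apply: linK => //; exact: set_mem.
(* [(a, b)] is in the lineality space of the graph, so it can be subtracted. *)
have [a Wa [b /linP[Hab HNab] abu]] := img l l0 _ Wu.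
have Hd : gr H (x - a, y - b) by have := convex_coneD Hcc Hxy HNab.
have yb : y - b = l *: (x - a).
  by rewrite scalerBr -[y](subrK (l *: x)) -abu addrAC [b - _]addrC addrK addrC.
have Wxa : lin K (x - a).
  have [xa0|xa0] := eqVneq (x - a) 0; first by rewrite xa0; exact: set_mem.
  apply: (eig l) => //; first by split=> //; rewrite -yb.
  by apply: convex_coneD => //; have /linP[] := Wa.
by rewrite -[x](subrK a) -[x - a]scale1r; exact: linK.
Qed.

(** Weak invariance provides an image [y] in [K] of [z *m p], which differs from
    [z] by an element of [lin K].  Passing from [y] to [y *m q] adds an element
    of [H 0 `&` K], which preserves both [K] and the graph. *)
Lemma reduced_gr_onto (R : realType) (n : nat)
    (H : 'rV[R]_n -> set 'rV[R]_n) (K : set 'rV[R]_n) (p q : 'M[R]_n)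
    (z : 'rV[R]_n) :
  convex_cone (gr H) -> convex_cone K -> weakly_invariant H K ->
  p *m p = p -> (forall x, lin K x <-> x *m p = 0) ->
  q *m q = q -> (forall y, (H 0 `&` K) y <-> y *m q = 0) ->
  K z -> exists y, reduced_gr H K p q (z *m p, y).
Proof.
move=> Hcc Kcc Kinv pp pK qq qK Kz.
have Kzp : K (z *m p).
  rewrite -[z *m p](subrK z) addrC; apply: convex_coneD => //.
  suff /linP[] : lin K (z *m p - z) by [].
  by apply/pK; rewrite mulmxBl -mulmxA pp subrr.
have [y [Hy Ky]] := Kinv _ Kzp.
have [Hyq Kyq] : (H 0 `&` K) (y *m q - y).
  by apply/qK; rewrite mulmxBl -mulmxA qq subrr.
have yqE : y *m q = y + (y *m q - y) by rewrite addrC subrK.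
exists (y *m q); split=> /=.
- have := convex_coneD (x := (z *m p, y)) (y := (0, y *m q - y)) Hcc Hy Hyq.
  by rewrite /gr/= addr0 -yqE.
- by [].
- by rewrite yqE; exact: convex_coneD.
- by rewrite -mulmxA pp.
- by rewrite -mulmxA qq.
Qed.

(** * The characterization of subspaces among invariant cones *)

Theorem theorem3p7 (R : realType) (n : nat)
    (H : 'rV[R]_n -> set 'rV[R]_n) (K : set 'rV[R]_n)
    (H_ccp : closed_convex_process H)
    (K_convex_cone : convex_cone K) (K_closed : closed K)
    (K_inv : weakly_invariant H K)
    (H0K_subspace : linear_subspace (H 0 `&` K))
    (linK_inv : weakly_invariant (min_linear_process H) (lin K))
    (linK_image : forall lambda : R, 0 <= lambda ->
       lin K `<=`
       process_image (shift_process (min_linear_process H) lambda) (lin K)) :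
  K = lin K <->
  (forall (lambda : R) (xi : 'rV[R]_n),
     0 <= lambda -> eigenpair H lambda xi -> K xi -> lin K xi).
Proof.
split=> [KlinK l xi _ _|eig]; first by rewrite {1}KlinK.
have [Hcc Hclosed] := H_ccp.
have [p pp pK] := subspace_projection (lin_subspace K_convex_cone).
have [q qq qK] := subspace_projection H0K_subspace.
pose A : {linear ('rV[R]_n * 'rV[R]_n)%type -> 'rV[R]_n} := mulmxr p \o fst.
pose B : {linear ('rV[R]_n * 'rV[R]_n)%type -> 'rV[R]_n} :=
  mulmxr p \o (fst \+ snd).
have cp : continuous (mulmxr p : 'rV[R]_n -> 'rV[R]_n).
  exact: rV_linear_continuous.
have cA : continuous A.
  by move=> g; apply: continuous_comp; [exact: cvg_fst|exact: cp].
have cB : continuous B.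
  move=> g; apply: continuous_comp; last exact: cp.
  by apply: cvgD; [exact: cvg_fst|exact: cvg_snd].
have KpE : [set z *m p | z in K] `<=`
    [set A g - B g | g in reduced_gr H K p q].
  apply: surjective_continuation => //.
  - exact: reduced_gr_convex_cone.
  - by move=> C; exact: reduced_gr_compact.
  - move=> g [_ Kg1 Kg2 _ _]; exists (g.1 + g.2) => //; exact: convex_coneD.
  - move=> t [x y] t01 Gxy Txy.
    exact: (reduced_gr_kernel (H := H) (K := K) (p := p) (q := q) (t := t)).
  - move=> _ [z Kz <-].
    have [y Gy] :=
      reduced_gr_onto Hcc K_convex_cone K_inv pp pK qq qK Kz.
    by exists (z *m p, y) => //=; rewrite -mulmxA pp.
apply/seteqP; split=> [z Kz|z []//].
have [[x y] [_ _ /= Ky _ _] zp] :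
    [set A g - B g | g in reduced_gr H K p q] (z *m p).
  by apply: KpE; exists z.
have /linP[_ Kzy] : lin K (z + y).
  apply/pK; rewrite mulmxDl -zp /= mulmxDl opprD addrA subrr add0r.
  by rewrite addNr.
apply/linP; split=> //.
by rewrite -[- z](subrK y) -opprD; exact: convex_coneD.
Qed.
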